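(* Let $n\geq 3$, $m\geq 2$, and let $\Gamma$ be an Abelian group of order $2mn$. Suppose $\Gamma$ has a subgroup $H$ of order $n$ such that either $n$ is odd, or $n$ is even and $H$ has a subgroup isomorphic to $Z_2\oplus Z_{2s}$ for some $s\geq 2$, and suppose the quotient group $\Gamma/H$ is cyclic. Then the generalized closed web $CW_{m,n}$ admits a $\Gamma$-harmonious labeling.
   Context: The generalized prism $Y_{m,n}$ is the Cartesian product $P_m\Box C_n$; it consists of $m$ copies $C^1,\dots,C^m$ of $C_n$ (layers), with corresponding vertices of consecutive layers joined by an edge. The generalized closed web $CW_{m,n}$ is obtained from $Y_{m,n}$ by adding one new vertex joined by an edge to every vertex of the top cycle $C^1$ (the vertices of degree three in an end layer); it has $2mn$ edges. For a graph $G=(V,E)$ with $q$ edges and a finite Abelian group $\Gamma$ of order $q$ (written additively), a $\Gamma$-harmonious labeling is an injection $f:V\to\Gamma$ such that the induced edge labeling $w(xy)=f(x)+f(y)$ is a bijection from $E$ to $\Gamma$. $Z_k$ denotes the cyclic group of order $k$. *)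

(* Defs.v *)
From HB Require Import structures.
From mathcomp Require Import all_boot all_order all_algebra all_fingroup all_solvable.

Set Implicit Arguments.
Unset Strict Implicit.
Unset Printing Implicit Defensive.

Import GRing.Theory.
Local Open Scope ring_scope.

(* Graphs are adjacency relations, meant to be symmetric and irreflexive (see
   [closed_web_sym] and [closed_web_irr]); an edge is an unordered pair, so
   each one is counted once. *)
Definition edges (V : finType) (adj : rel V) : {set {set V}} :=
  [set [set p.1; p.2] | p : V * V & adj p.1 p.2].

Definition path_graph (m : nat) : rel 'I_m :=
  fun i j => (i.+1 == j)%N || (j.+1 == i)%N.

(* [ordS] is the successor modulo n; this is the cycle C_n for n >= 3. *)
Definition cycle_graph (n : nat) : rel 'I_n :=
  fun i j => (ordS i == j) || (ordS j == i).

Definition cartesian_product (V W : finType) (g : rel V) (h : rel W) :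
  rel (V * W) :=
  fun x y => (x.1 == y.1) && h x.2 y.2 || g x.1 y.1 && (x.2 == y.2).

Definition prism (m n : nat) : rel ('I_m * 'I_n) :=
  cartesian_product (@path_graph m) (@cycle_graph n).

(* [None] is the additional vertex; the top cycle is the layer of index 0. *)
Definition closed_web (m n : nat) : rel (option ('I_m * 'I_n)) :=
  fun x y =>
    match x, y with
    | Some u, Some v => prism u v
    | Some u, None | None, Some u => u.1 == 0%N :> nat
    | None, None => false
    end.

(* On an edge {x, y} this is f x + f y, see [edge_labelE]. *)
Definition edge_label (V : finType) (Gamma : finZmodType) (f : V -> Gamma)
  (e : {set V}) : Gamma := \sum_(x in e) f x.

(* That #|Gamma| is the number of edges follows from the bijection. *)
Definition harmonious_labeling (V : finType) (adj : rel V)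
  (Gamma : finZmodType) (f : V -> Gamma) : Prop :=
  injective f /\
  bijective (fun e : {e : {set V} | e \in edges adj} => edge_label f (val e)).

Lemma closed_web_sym (m n : nat) : symmetric (@closed_web m n).
Proof.
case=> [[i j]|] [[k l]|] //=.
by rewrite /prism /cartesian_product /path_graph /cycle_graph /=
  (eq_sym k i) (eq_sym l j) (orbC (k.+1 == i)%N) (orbC (ordS l == j)).
Qed.

Lemma closed_web_irr (m n : nat) : (1 < n)%N -> irreflexive (@closed_web m n).
Proof.
move=> n1 [[i j]|] //=.
rewrite /prism /cartesian_product /path_graph /cycle_graph /= !eqxx !orbb.
rewrite andbT (gtn_eqF (ltnSn i)) orbF.
apply/negbTE/eqP => /(congr1 val) /=.
have := ltn_ord j; rewrite leq_eqVlt => /orP[/eqP e|h].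
  by rewrite e modnn => j0; move: n1; rewrite -e -j0.
by rewrite modn_small // => /eqP; rewrite (gtn_eqF (ltnSn j)).
Qed.

Lemma edge_labelE (V : finType) (Gamma : finZmodType) (f : V -> Gamma)
  (x y : V) : x != y -> edge_label f [set x; y] = f x + f y.
Proof. by move=> xy; rewrite /edge_label big_setU1 ?inE //= big_set1. Qed.

(* Main.v *)
(** Write a group multiplicatively and call it harmonious when its elements can
    be listed cyclically as [h 0, h 1, ...] with pairwise distinct consecutive
    products.  If [H] is harmonious and [g] generates [Gamma / H], label vertex
    [(i, j)] by [g ^+ i * h (i + j)] and the additional vertex by [g^-1]: the
    cycle edges of layer [i] fill the coset [g ^+ (2 * i)] of [H], the edges
    between layers [i] and [i + 1] the coset [g ^+ (2 * i + 1)], because the shift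
    by [i] turns a vertical edge into a consecutive pair, and the spokes fill
    the coset [g ^- 1].

    It remains that an abelian group is harmonious if it has odd order, or if its
    Sylow 2-subgroup is noncyclic and it is not an elementary abelian 2-group.
    This goes by induction on the order.  A cyclic quotient of odd order is
    removed from the top, which leaves 2-groups and the case where the subgroup
    is elementary abelian.  A subgroup isomorphic to [Z_2 ^ 2] or [Z_2 ^ 3] is
    removed from the bottom.  What remains is [Z_2 * Z_4], [Z_4 * Z_4] and the
    2-groups that are cyclic modulo a Klein four-group; the latter are reached
    from [Z_2 * Z_8] or [Z_2 ^ 2 * Z_4] by repeated extensions of index two. *)

Require Import Defs.
From HB Require Import structures.
From mathcomp Require Import all_boot all_order all_algebra all_fingroup all_solvable.
From mathcomp Require Import zify.

Set Implicit Arguments.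
Unset Strict Implicit.
Unset Printing Implicit Defensive.
Local Open Scope group_scope.

(** * Harmonious groups *)

(** Listings are periodic functions on [nat], so that the wrap from the last entry to the first is
    no special case. When [G] is a group, injectivity makes both the entries and the products
    exhaust it. *)
Definition harmonious_seq (gT : finGroupType) (G : {set gT}) (h : nat -> gT) :=
  [/\ forall i, h i \in G, forall i, h (i + #|G|)%N = h i,
      {in gtn #|G| &, injective h}
    & {in gtn #|G| &, injective (fun i => h i * h i.+1)}].

Definition harmonious (gT : finGroupType) (G : {set gT}) :=
  exists h, harmonious_seq G h.

Lemma periodic_modn (T : Type) (n : nat) (h : nat -> T) (i : nat) :
  (forall i, h (i + n)%N = h i) -> h (i %% n) = h i.
Proof.
move=> hP; rewrite [in RHS](divn_eq i n) addnC.
by elim: (i %/ n) => [|q IHq]; rewrite ?addn0 // mulSn addnCA addnC hP.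
Qed.

Lemma harmonious_seq_eq (gT : finGroupType) (G : {group gT}) (h : nat -> gT)
    (i j : nat) :
  harmonious_seq G h -> h i = h j -> i = j %[mod #|G|].
Proof.
case=> _ hP hI _ eq_h.
by apply: hI; rewrite ?unfold_in /= ?ltn_pmod // !periodic_modn.
Qed.

Lemma harmonious_seq_sum_eq (gT : finGroupType) (G : {group gT})
    (h : nat -> gT) (i j : nat) :
  harmonious_seq G h -> h i * h i.+1 = h j * h j.+1 -> i = j %[mod #|G|].
Proof.
case=> _ hP _ hI eq_h.
have hPs k : h (k + #|G|)%N * h (k + #|G|).+1 = h k * h k.+1.
  by rewrite -addSn !hP.
apply: hI; rewrite ?unfold_in /= ?ltn_pmod //.
by rewrite !(periodic_modn _ (h := fun k => h k * h k.+1)).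
Qed.

(* [F b j] is the entry of index [b * t + j]; the successor of the last column
   wraps to column 0 of the next row. *)
Lemma grid_harmonious (gT : finGroupType) (G : {group gT}) (r t : nat)
    (F : nat -> nat -> gT) :
    0 < t -> #|G| = (r * t)%N ->
    (forall b j, F b j \in G) ->
    (forall b j, F (b + r) j = F b j) ->
    (forall b j b' j', b < r -> j < t -> b' < r -> j' < t ->
       F b j = F b' j' -> b = b' /\ j = j') ->
    (forall b j b' j', b < r -> j < t -> b' < r -> j' < t ->
       F b j * (if j.+1 < t then F b j.+1 else F b.+1 0) =
       F b' j' * (if j'.+1 < t then F b' j'.+1 else F b'.+1 0) ->
       b = b' /\ j = j') ->
  harmonious_seq G (fun i => F (i %/ t) (i %% t)).
Proof.
move=> t0 cG FG FP FI FS.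
have grid i : i \in gtn #|G| -> i %/ t < r /\ i %% t < t.
  by rewrite unfold_in /= cG => lt_i; rewrite ltn_divLR // ltn_pmod.
have Fnext i : F (i.+1 %/ t) (i.+1 %% t) =
    if (i %% t).+1 < t then F (i %/ t) (i %% t).+1 else F (i %/ t).+1 0.
  rewrite {1 2}(divn_eq i t) -addnS divnMDl // modnMDl.
  case: ltnP => [lt_it | ge_it].
    by rewrite (divn_small lt_it) (modn_small lt_it) addn0.
  have -> : (i %% t).+1 = t by apply/eqP; rewrite eqn_leq ltn_pmod.
  by rewrite divnn t0 modnn addn1.
split=> [i // | i | i j Gi Gj /= | i j Gi Gj /=].
- by rewrite cG addnC divnMDl // modnMDl addnC FP.
- have [[i1 i2] [j1 j2]] := (grid _ Gi, grid _ Gj).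
  move=> /(FI _ _ _ _ i1 i2 j1 j2)[e1 e2].
  by rewrite (divn_eq i t) (divn_eq j t) e1 e2.
- have [[i1 i2] [j1 j2]] := (grid _ Gi, grid _ Gj).
  rewrite !Fnext => /(FS _ _ _ _ i1 i2 j1 j2)[e1 e2].
  by rewrite (divn_eq i t) (divn_eq j t) e1 e2.
Qed.

(* With [r = #|G / K|], the entry of index [q * r + j] is [c ^+ j * k q] for even
   [j] and [c ^+ j * k q.+1] for odd [j]; since [r] is odd, every product is a
   power of [c] times [k q * k q.+1], also at the wrap. *)
Lemma harmonious_odd_ext (gT : finGroupType) (G K : {group gT}) (c : gT) :
    abelian G -> K \subset G -> c \in G -> G / K = <[coset K c]> ->
    odd #|G / K| -> harmonious K ->
  harmonious G.
Proof.
move=> abG sKG Gc defQ oddQ [k hk]; have [kK kP _ _] := hk.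
set r := #|G / K| in oddQ; set d := coset K c.
have nKG : G \subset 'N(K) by rewrite (sub_abelian_norm abG).
have od : #[d] = r by rewrite /r defQ.
have r0 : 0 < r by rewrite -od order_gt0.
have kG i : k i \in G by apply: (subsetP sKG).
have com : {in G &, commutative mulg} by move=> x y /(centsP abG)Cx /Cx.
have cosF i x : x \in K -> coset K (c ^+ i * x) = d ^+ i.
  move=> Kx; have [Nc Nx] := (subsetP nKG c Gc, subsetP (normG K) x Kx).
  by rewrite morphM ?groupX //= (coset_id Kx) mulg1 morphX.
(* [e j] is the exponent of [c] in the product at column [j]. The last column is followed by
   exponent 0, and [e j] is still [1 + 2 j] modulo [r]. *)
pose e j := if j.+1 < r then (j + j.+1)%N else j.
have e_mod j : j < r -> e j = (1 + j.*2)%N %[mod r].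
  rewrite /e leq_eqVlt -addnn => /orP[/eqP<- | ->]; last by rewrite addnS.
  by rewrite ltnn addnA add1n modnDl.
have eq_e : forall (m n : nat) (x y : gT), x \in K -> y \in K ->
    c ^+ m * x = c ^+ n * y ->
    m = n %[mod r].
  move=> m n x y Kx Ky /(congr1 (coset K)); rewrite !cosF // => /eqP.
  by rewrite eq_expg_mod_order od => /eqP.
have cG : #|G| = (#|K| * r)%N by rewrite /r card_quotient // Lagrange.
pose F q j := c ^+ j * k (q + odd j)%N.
exists (fun i => F (i %/ r) (i %% r)).
apply: (grid_harmonious (r := #|K|) (F := F)); rewrite /F //.
- by move=> q j; rewrite groupM ?groupX.
- by move=> q j; rewrite addnAC kP.
- move=> q j q' j' lq lj lq' lj' eF.
  have ej : j = j' by have:= eq_e _ _ _ _ (kK _) (kK _) eF; rewrite !modn_small.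
  subst j'; split=> //; move/mulgI: eF => /(harmonious_seq_eq hk)/eqP.
  by rewrite eqn_modDr !modn_small // => /eqP.
- have sumE i l : l < r ->
    c ^+ l * k (i + odd l)%N *
      (if l.+1 < r then c ^+ l.+1 * k (i + odd l.+1)%N
       else c ^+ 0 * k (i.+1 + odd 0)%N) = c ^+ e l * (k i * k i.+1).
    move=> lr; rewrite /e; case: ifP => [_ | /negbT].
      rewrite -mulgA (mulgA (k _)) (com (k _)) ?groupX // !mulgA -expgD -!mulgA.
      congr (_ * _); rewrite /= (addnC i) (addnC i).
      by case: (odd l); rewrite //= (com (k i)).
    rewrite -leqNgt => rl; have Dl : l.+1 = r by apply/eqP; rewrite eqn_leq lr.
    have /negbTE-> : ~~ odd l by move: oddQ; rewrite -Dl.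
    by rewrite addn0 expg0 mul1g addn0 mulgA.
  move=> q j q' j' lq lj lq' lj'; rewrite !sumE // => eF.
  have Ks i : k i * k i.+1 \in K by rewrite groupM.
  have ej : j = j'.
    have:= eq_e _ _ _ _ (Ks _) (Ks _) eF; rewrite (e_mod j) // (e_mod j') // => /eqP.
    rewrite eqn_modDl -!muln2 => /eqP.
    wlog le_jj' : j j' lj lj' {eF} / j <= j'.
      move=> IH eq2; case/orP: (leq_total j j') => le; first exact: IH.
      by apply/esym/IH.
    move/eqP; rewrite eq_sym eqn_mod_dvd ?leq_mul2r ?le_jj' ?orbT //.
    (* Oddness of [r] allows 2 to be cancelled. *)
    rewrite -mulnBl Gauss_dvdl ?coprimen2 // => /dvdn_leq.
    rewrite subn_gt0 => dv; apply/eqP; rewrite eqn_leq le_jj' leqNgt.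
    by apply/negP=> /dv; rewrite leqNgt (leq_ltn_trans (leq_subr _ _) lj').
  subst j'; split=> //; move/mulgI: eF => /(harmonious_seq_sum_eq hk).
  by rewrite !modn_small.
Qed.

(* The listing is made of the blocks [k (2 q)], [k (2 q + 1)], [c * k (2 q + 2)],
   [c * k (2 q + 3)]; the even-indexed products of [k] are used twice, the second
   time multiplied by [c ^+ 2]. *)
Lemma harmonious_double (gT : finGroupType) (G K : {group gT}) (c : gT)
    (k : nat -> gT) :
    abelian G -> K \subset G -> #|G| = (#|K| * 2)%N -> ~~ odd #|K| ->
    c \in G -> c \notin K -> c ^+ 2 \in K -> harmonious_seq K k ->
    (forall i j, ~~ odd i -> ~~ odd j ->
       k i * k i.+1 != c ^+ 2 * (k j * k j.+1)) ->
  exists2 h, harmonious_seq G h & forall i, ~~ odd i -> h i * h i.+1 \in K.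
Proof.
move=> abG sKG cG evK Gc nKc Kc2 hk nsum; have [kK kP _ _] := hk.
have com : {in G &, commutative mulg} by move=> x y /(centsP abG)Cx /Cx.
have kG i : k i \in G by apply: (subsetP sKG).
have sK i : k i * k i.+1 \in K by rewrite groupM.
have c2K i : c ^+ 2 * (k i * k i.+1) \in K by rewrite groupM.
have eq_par m n : m = n %[mod #|K|] -> odd m = odd n.
  by rewrite -(odd_mod m (negbTE evK)) -(odd_mod n (negbTE evK)) => ->.
have eq_half a q q' : q < #|K|./2 -> q' < #|K|./2 ->
    (q.*2 + a = q'.*2 + a %[mod #|K|])%N -> q = q'.
  move=> lq lq' /eqP; rewrite eqn_modDr !modn_small.
  - by move/eqP/double_inj.
  - by rewrite -(even_halfK evK) ltn_double.
  - by rewrite -(even_halfK evK) ltn_double.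
have cK x y : x \in K -> y \in K -> c * x = y -> False.
  move=> Kx Ky /(canRL (mulgK x)) ec; move: nKc.
  by rewrite ec groupM ?groupV.
pose F q j := (if j < 2 then 1 else c) * k (q.*2 + j)%N.
have FE q : [/\ F q 0 = k q.*2, F q 1%N = k q.*2.+1,
                F q 2 = c * k q.*2.+2 & F q 3 = c * k q.*2.+3].
  by rewrite /F /= !mul1g !addnS !addn0.
pose S q j := F q j * (if j.+1 < 4 then F q j.+1 else F q.+1 0).
(* Columns 0 and 2 give products in [K], kept apart by [nsum]. Columns 1 and 3 give [c] times the
   odd-indexed and the even-indexed products of [k], which differ by the parity of the index. *)
have SE q : [/\ S q 0 = k q.*2 * k q.*2.+1, S q 1%N = c * (k q.*2.+1 * k q.*2.+2),
               S q 2 = c ^+ 2 * (k q.*2.+2 * k q.*2.+3)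
             & S q 3 = c * (k q.*2.+2 * k q.*2.+3)].
  have [F0 F1 F2 F3] := FE q; have [F0' _ _ _] := FE q.+1.
  rewrite /S /= F0 F1 F2 F3 F0' doubleS; split=> //.
  - by rewrite mulgA (com _ c) // mulgA.
  - by rewrite -!mulgA; congr (c * _); rewrite !mulgA (com _ c).
  - by rewrite -mulgA (com (k _)).
have seqF : harmonious_seq G (fun i => F (i %/ 4) (i %% 4)).
  apply: (grid_harmonious (r := #|K|./2) (F := F)) => //.
  - by rewrite cG -{1}(even_halfK evK) -muln2 -mulnA.
  - by move=> b j; rewrite /F groupM //; case: ifP.
  - by move=> b j; rewrite /F doubleD (even_halfK evK) addnAC kP.
  - move=> q j q' j' lq lj lq' lj' eF.
    suff ej : j = j'.
      move: eF; rewrite -ej /F => /mulgI eF0.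
      have {eF0}eF := harmonious_seq_eq hk eF0.
      by rewrite (eq_half _ _ _ lq lq' eF).
    have [F0 F1 F2 F3] := FE q; have [F0' F1' F2' F3'] := FE q'.
    case: j j' lj lj' eF => [|[|[|[|//]]]] [|[|[|[|//]]]] _ _ //;
    rewrite ?F0 ?F1 ?F2 ?F3 ?F0' ?F1' ?F2' ?F3' => eF; exfalso;
    try (by apply: (cK _ _ _ _ eF)); try (by apply: (cK _ _ _ _ (esym eF)));
    try move/mulgI: eF => eF; have /eq_par := harmonious_seq_eq hk eF;
    by rewrite /= !odd_double.
  - move=> q j q' j' lq lj lq' lj' eF; rewrite -!/(S _ _) in eF.
    have [S0 S1 S2 S3] := SE q; have [S0' S1' S2' S3'] := SE q'.
    suff ej : j = j'.
      split=> //; subst j'; case: j lj lj' eF => [|[|[|[|//]]]] _ _;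
      rewrite ?S0 ?S1 ?S2 ?S3 ?S0' ?S1' ?S2' ?S3' => eF;
      try move/mulgI: eF => eF; move/(harmonious_seq_sum_eq hk): eF.
      - by rewrite -[q.*2]addn0 -[q'.*2]addn0 => /eq_half; apply.
      - by rewrite -[q.*2]addn0 -[q'.*2]addn0 -!addnS => /eq_half; apply.
      - by rewrite -[q.*2]addn0 -[q'.*2]addn0 -!addnS => /eq_half; apply.
      - by rewrite -[q.*2]addn0 -[q'.*2]addn0 -!addnS => /eq_half; apply.
    case: j j' lj lj' eF => [|[|[|[|//]]]] [|[|[|[|//]]]] _ _ //;
    rewrite ?S0 ?S1 ?S2 ?S3 ?S0' ?S1' ?S2' ?S3' => eF; exfalso;
    try (by apply: (cK _ _ _ _ eF)); try (by apply: (cK _ _ _ _ (esym eF)));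
    try (by move/eqP: eF; apply/negP/nsum; rewrite /= ?odd_double);
    try (by move/esym/eqP: eF; apply/negP/nsum; rewrite /= ?odd_double);
    move/mulgI: eF => eF; have /eq_par := harmonious_seq_sum_eq hk eF;
    by rewrite /= !odd_double.
exists (fun i => F (i %/ 4) (i %% 4)) => // i evi.
(* An even position is 0 or 2 modulo 4, so its successor stays in the same row. *)
have ->: F (i.+1 %/ 4) (i.+1 %% 4) = F (i %/ 4) (i %% 4).+1.
  rewrite {1 2}(divn_eq i 4) -addnS divnMDl // modnMDl.
  have: i %% 4 < 4 by rewrite ltn_pmod.
  have: ~~ odd (i %% 4) by rewrite odd_mod.
  by case: (i %% 4) => [|[|[|[|]]]] //= _ _; rewrite addn0.
have: i %% 4 < 4 by rewrite ltn_pmod.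
have: ~~ odd (i %% 4) by rewrite odd_mod.
have [S0 S1 S2 S3] := SE (i %/ 4).
case: (i %% 4) => [|[|[|[|]]]] //= _ _; first by move: S0; rewrite /S /= => ->.
by move: S2; rewrite /S /= => ->; rewrite groupM.
Qed.

(** * Lifting through a quotient *)

Definition cyclic_listing (gT : finGroupType) (A : {set gT}) (p : nat -> gT) :=
  [/\ forall b, p b \in A, forall b, p (b + #|A|)%N = p b
    & {in gtn #|A| &, injective p}].

(* The listing of [G] runs [#|A|] times around a harmonious listing of [G / A] of
   length [t], alternately backwards and forwards, a lap starting at layer 1 each
   time; layers are numbered from 1 to [t]. Lap [b] meets layer [l] in the [b]-th
   entry of a listing of [A], which is [P1] for [l = 1]. On the other layers
   [PA] and [PB] alternate, from [PA] on layer 2 to [PB] on layer [t], with one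
   [PC] inserted on layer 3 when [t] is even. *)
Definition layer_listing (gT : finGroupType) (P1 PA PB PC : nat -> gT) (t l : nat) :=
  if l == 1%N then P1 else if l == 2 then PA
  else if (l == 3) && ~~ odd t then PC
  else if odd t (+) odd l then PA else PB.

(** Counting its passage to the next lap, each lap crosses between layers [i] and [i + 1] once for
    every [i] modulo [t]. The class of the product modulo [A] tells [i], as the listing of the
    quotient is harmonious; the remaining factor in [A] tells the lap, by the injectivity
    hypotheses. Evenness of [#|A|] lets the alternating directions close up. *)
Lemma harmonious_quotient (gT : finGroupType) (G A : {group gT})
    (P1 PA PB PC : nat -> gT) :
    abelian G -> A \subset G -> ~~ odd #|A| ->
    2 < #|G / A| -> harmonious (G / A) ->
    cyclic_listing A P1 -> cyclic_listing A PA ->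
    cyclic_listing A PB -> cyclic_listing A PC ->
    {in gtn #|A| &, injective (fun b => PA b * PB b)} ->
    {in gtn #|A| &, injective (fun b => PA b * PC b)} ->
    {in gtn #|A| &, injective (fun b => PB b * PC b)} ->
    {in gtn #|A| &, injective (fun b => PB b * P1 (odd b + b)%N)} ->
    {in gtn #|A| &, injective (fun b => PA b * P1 (~~ odd b + b)%N)} ->
  harmonious G.
Proof.
move=> abG sAG evA t3 [x hx] hP1 hPA hPB hPC iAB iAC iBC iB1 iA1.
have [xQ xP _ _] := hx.
set t := #|G / A| in t3 xP.
have com : {in G &, commutative mulg} by move=> u v /(centsP abG)Cu /Cu.
have nAG : G \subset 'N(A) by rewrite (sub_abelian_norm abG).
pose L l := layer_listing P1 PA PB PC t l.
have LP l : cyclic_listing A (L l).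
  by rewrite /L /layer_listing; do !case: ifP.
have LA l b : L l b \in A by case: (LP l).
have LG l b : L l b \in G by apply: (subsetP sAG).
pose y i := repr (x i).
have yE i : coset A (y i) = x i by rewrite coset_reprK.
have yP i : y (i + t)%N = y i by rewrite /y xP.
have yG i : y i \in G.
  have <- : coset A @*^-1 (G / A) = G.
    by rewrite quotientGK // -sub_abelian_normal.
  by rewrite mem_morphpre ?repr_coset_norm //= yE.
have LL l : 1 < l -> l < t ->
    {in gtn #|A| &, injective (fun b => L l b * L l.+1 b)}.
  have comL f g : {in gtn #|A| &, injective (fun b => f b * g b)} ->
      (forall b, f b \in A) -> (forall b, g b \in A) ->
      {in gtn #|A| &, injective (fun b => g b * f b)}.
    move=> fgI Af Ag i j ri rj eq_ij; apply: fgI => //.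
    by rewrite (com (f i)) ?(com (f j)) // ?(subsetP sAG).
  have AA : forall b, PA b \in A by case: hPA.
  have AB : forall b, PB b \in A by case: hPB.
  have AC : forall b, PC b \in A by case: hPC.
  case: l => [|[|[|[|l]]]] //= _ lt; rewrite /L /layer_listing /=.
  - by case: (odd t).
  - by case: (odd t) => //=; apply: comL.
  - by case: (odd t); case: (odd l) => //=; apply: comL.
(* [l b j] is the layer at step [j] of lap [b]: 1, 2, ..., t on odd laps and 1, t, ..., 2 on even
   ones. [s b j] numbers the crossing that follows, [t] standing for the one between layers [t] and
   1. *)
pose l b j := if odd b then j.+1 else if j == 0 then 1%N else (t.+1 - j)%N.
pose s b j := if odd b then j.+1 else (t - j)%N.
(* The factor in [A] at crossing [i] of lap [b]. The entry on layer 1 belongs to lap [b] or [b + 1]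
   according to the direction, whence the parity terms. *)
pose D i b := if i == t then PB b * P1 (odd b + b)%N
  else if i == 1%N then PA b * P1 (~~ odd b + b)%N else L i b * L i.+1 b.
have DA i b : D i b \in A.
  by rewrite /D; case: ifP => _; [|case: ifP => _];
     rewrite groupM //; case: hP1 hPA hPB => ? _ _ [? _ _] [? _ _].
have DI i : 0 < i <= t -> {in gtn #|A| &, injective (D i)}.
  case/andP=> i0 it; rewrite /D; case: eqP => [_ // | /eqP nit].
  case: eqP => [_ // | /eqP ni1]; apply: LL; first by case: (i) i0 ni1 => [|[]].
  by rewrite ltn_neqAle nit.
pose F b j := y (l b j) * L (l b j) b.
pose S b j := F b j * (if j.+1 < t then F b j.+1 else F b.+1 0).
have Lt : L t = PB.
  rewrite /L /layer_listing; case: (t) t3 => [|[|[|[|m]]]] //= _.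
  by rewrite negbK addbb.
have SE b j : j < t -> S b j = y (s b j) * y (s b j).+1 * D (s b j) b.
  move=> jt; rewrite /S /F /s /D /l.
  have swap u v w z : u \in G -> v \in G -> w \in G -> z \in G ->
      u * v * (w * z) = u * w * (v * z).
    by move=> *; rewrite -!mulgA (mulgA v) (com v w) // !mulgA.
  have G1 c : P1 c \in G by apply: (LG 1%N).
  have GA c : PA c \in G by apply: (LG 2).
  have GB c : PB c \in G by rewrite -Lt.
  have y1 : y t.+1 = y 1%N by rewrite -add1n yP.
  have L1 : L 1%N = P1 by [].
  have L2 : L 2 = PA by [].
  case odd_b: (odd b) => /=; case: ltnP => /= jt'.
  - rewrite swap // ?(ltn_eqF jt'); case: j jt jt' => [|j] jt jt' /=.
      by rewrite L1 L2 (com (P1 b)).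
    by [].
  - have ->: j.+1 = t by apply/eqP; rewrite eqn_leq jt.
    by rewrite odd_b /= Lt eqxx swap ?y1.
  - case: j jt jt' => [|j] jt jt' /=; last first.
      have -> : (t - j.+1 == t)%N = false by lia.
      have -> : (t - j.+1 == 1)%N = false by lia.
      have -> : (t.+1 - j.+1 = (t - j.+1).+1)%N by lia.
      by rewrite swap // (com (y _)) // (com (L _ _)) //.
    rewrite subn0 eqxx add0n y1 subSS subn0 Lt.
    by rewrite swap // L1; congr (_ * _); apply: com.
  - have jE : j = t.-1 by lia.
    have -> : (t - j = 1)%N by lia.
    have -> : (t.+1 - j = 2)%N by lia.
    have -> : (j == 0)%N = false by lia.
    have -> : (1 == t)%N = false by lia.
    by rewrite odd_b /= L1 L2 add1n swap // (com (y _)).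
have eq_coset i i' u v : u \in A -> v \in A -> i \in G -> i' \in G ->
    i * u = i' * v -> coset A i = coset A i'.
  move=> Au Av Gi Gi' /(congr1 (coset A)).
  have [Nu Nv] := (subsetP (normG A) u Au, subsetP (normG A) v Av).
  have [Ni Ni'] := (subsetP nAG i Gi, subsetP nAG i' Gi').
  by rewrite !morphM //= (coset_id Au) (coset_id Av) !mulg1.
have small i j : 0 < i <= t -> 0 < j <= t -> i = j %[mod t] -> i = j.
  case/andP=> i0 it /andP[j0 jt] /eqP.
  rewrite -(subnKC i0) -(subnKC j0) eqn_modDl !modn_small; lia.
exists (fun i => F (i %/ t) (i %% t)).
apply: (grid_harmonious (r := #|A|) (F := F)).
- by apply: ltn_trans t3.
- by rewrite /t card_quotient // Lagrange.
- by move=> b j; rewrite groupM.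
- move=> b j; rewrite /F /l oddD (negbTE evA) addbF.
  by have [_ -> _] := LP (l b j).
- move=> b j b' j' lb lj lb' lj' eF.
  have lt c i : i < t -> 0 < l c i <= t by rewrite /l; do 2?[case: ifP => ?]; lia.
  have el : l b j = l b' j'.
    apply: small; rewrite ?lt //; apply: (harmonious_seq_eq hx).
    by rewrite -!yE; apply: (eq_coset _ _ _ _ _ _ _ _ eF).
  move: eF; rewrite /F el => /mulgI eL; have [_ _ LI] := LP (l b' j').
  have eb := LI _ _ lb lb' eL; split=> //; move: el; rewrite eb /l.
  by do !case: ifP => ?; lia.
- move=> b j b' j' lb lj lb' lj'.
  rewrite -/(S b j) -/(S b' j') !SE // => eS.
  have st c i : i < t -> 0 < s c i <= t by rewrite /s; case: ifP => ?; lia.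
  have es : s b j = s b' j'.
    apply: small; rewrite ?st //; apply: (harmonious_seq_sum_eq hx).
    rewrite -!yE -!morphM ?(subsetP nAG) //.
    by apply: (eq_coset _ _ _ _ _ _ _ _ eS); rewrite ?groupM.
  move: eS; rewrite es => /mulgI /(DI _ (st _ _ lj') _ _ lb lb') eb.
  by split=> //; move: es; rewrite eb /s; case: ifP => ?; lia.
Qed.

(** * Products of three cyclic groups *)

(** Products of two cyclic groups are covered by a generator 1 of order 1. *)
Definition box (gT : finGroupType) (G : {set gT}) (a b c : gT) (p q r : nat) :=
  [/\ abelian G, <[a]> \x <[b]> \x <[c]> = G, #[a] = p, #[b] = q & #[c] = r].

(* Exponent triples stand for elements of [<[a]> \x <[b]> \x <[c]>]. *)
Definition box_elt (gT : finGroupType) (a b c : gT) (u : nat * nat * nat) :=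
  a ^+ u.1.1 * b ^+ u.1.2 * c ^+ u.2.

Definition box_range (p q r : nat) (u : nat * nat * nat) :=
  [&& u.1.1 < p, u.1.2 < q & u.2 < r].

Definition box_add (p q r : nat) (u v : nat * nat * nat) :=
  ((u.1.1 + v.1.1) %% p, (u.1.2 + v.1.2) %% q, (u.2 + v.2) %% r)%N.

Lemma box_intro (gT : finGroupType) (G : {group gT}) (a b c : gT) :
    abelian G -> a \in G -> b \in G -> c \in G ->
    <[a]> :&: <[b]> = 1 -> (<[a]> <*> <[b]>) :&: <[c]> = 1 ->
  box (<[a]> <*> <[b]> <*> <[c]>) a b c #[a] #[b] #[c].
Proof.
move=> abG Ga Gb Gc tiab tic.
have sG : <[a]> <*> <[b]> <*> <[c]> \subset G by rewrite !join_subG !cycle_subG Ga Gb.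
have sG' : <[a]> <*> <[b]> \subset G by rewrite !join_subG !cycle_subG Ga Gb.
have cG (A B : {set gT}) : A \subset G -> B \subset G -> B \subset 'C(A).
  by move=> sA sB; apply: subset_trans (centsS sA abG).
split=> //; first exact: abelianS sG abG.
by rewrite (dprodEY _ tiab) ?dprodEY // cG ?cycle_subG.
Qed.

Lemma box_joingE (gT : finGroupType) (G : {group gT}) (a b c : gT) (p q r : nat) :
  box G a b c p q r -> <[a]> <*> <[b]> <*> <[c]> = G.
Proof.
case=> _ defG _ _ _; have [[A _ defA _] _ _ _] := dprodP defG.
by rewrite (dprodWY defA) -(dprodWY defG) defA.
Qed.

Lemma box_card (gT : finGroupType) (G : {group gT}) (a b c : gT) (p q r : nat) :
  box G a b c p q r -> #|G| = (p * q * r)%N.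
Proof.
case=> _ defG <- <- <-.
have [[A _ defA _] _ _ _] := dprodP defG; rewrite defA in defG.
by rewrite -(dprod_card defG) -(dprod_card defA).
Qed.

Lemma box_gen (gT : finGroupType) (G : {group gT}) (a b c : gT) (p q r : nat) :
  box G a b c p q r -> [/\ a \in G, b \in G & c \in G].
Proof.
move/box_joingE=> <-.
have sub := subsetP (joing_subl (<[a]> <*> <[b]>) <[c]>).
split; last exact: (subsetP (joing_subr _ _)) (cycle_id c).
  exact/sub/(subsetP (joing_subl _ _))/cycle_id.
exact/sub/(subsetP (joing_subr _ _))/cycle_id.
Qed.

Lemma box_elt_mem (gT : finGroupType) (G : {group gT}) (a b c : gT)
    (p q r : nat) u :
  box G a b c p q r -> box_elt a b c u \in G.
Proof. by case/box_gen=> *; rewrite /box_elt !groupM ?groupX. Qed.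

Lemma box_eltM (gT : finGroupType) (G : {group gT}) (a b c : gT)
    (p q r : nat) u v :
  box G a b c p q r ->
  box_elt a b c u * box_elt a b c v = box_elt a b c (box_add p q r u v).
Proof.
move=> boxG; have [Ga Gb Gc] := box_gen boxG.
case: boxG => abG _ <- <- <-.
have com : {in G &, commutative mulg} by move=> x y /(centsP abG)Cx /Cx.
have swap x y z w : y \in G -> z \in G -> x * y * (z * w) = x * z * (y * w).
  by move=> Gy Gz; rewrite !mulgA -(mulgA x y) (com y z) // !mulgA.
rewrite /box_elt /= !expg_mod_order !expgD.
by rewrite swap ?groupM ?groupX // (swap (a ^+ _)) ?groupX.
Qed.

Lemma box_elt_inj (gT : finGroupType) (G : {group gT}) (a b c : gT)
    (p q r : nat) u v :
  box G a b c p q r -> box_range p q r u -> box_range p q r v ->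
  box_elt a b c u = box_elt a b c v -> u = v.
Proof.
case=> _ defG <- <- <- /and3P[u1 u2 u3] /and3P[v1 v2 v3] eq_uv.
have [[A _ defA _] _ _ _] := dprodP defG; rewrite defA in defG.
have Aab i j : a ^+ i * b ^+ j \in A.
  by rewrite -(dprodW defA) mem_mulg ?mem_cycle.
have expI x i j : i < #[x] -> j < #[x] -> x ^+ i = x ^+ j -> i = j.
  by move=> li lj /eqP; rewrite eq_expg_mod_order !modn_small // => /eqP.
have Ge : box_elt a b c v \in G by rewrite -(dprodW defG) mem_mulg ?mem_cycle ?Aab.
have [y [z [_ _ _ uq]]] := mem_dprod defG Ge.
have [eu1 eu2] := uq _ _ (Aab _ _) (mem_cycle _ _) (esym eq_uv).
have [ev1 ev2] := uq _ _ (Aab _ _) (mem_cycle _ _) (erefl _).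
have [y' [z' [_ _ _ uq']]] := mem_dprod defA (Aab v.1.1 v.1.2).
have [eu3 eu4] := uq' _ _ (mem_cycle _ _) (mem_cycle _ _) (etrans ev1 (esym eu1)).
have [ev3 ev4] := uq' _ _ (mem_cycle _ _) (mem_cycle _ _) (erefl _).
have e1 := expI _ _ _ _ u1 v1 (etrans eu3 (esym ev3)).
have e2 := expI _ _ _ _ u2 v2 (etrans eu4 (esym ev4)).
have e3 := expI _ _ _ _ u3 v3 (etrans eu2 (esym ev2)).
by rewrite [u]surjective_pairing [u.1]surjective_pairing e1 e2 e3 -!surjective_pairing.
Qed.

(** Turns injectivity into a test on exponent triples, decided by evaluation once [f] and [n] are
    concrete. *)
Lemma box_injective (gT : finGroupType) (G : {group gT}) (a b c : gT)
    (p q r n : nat) (f : nat -> nat * nat * nat) :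
    box G a b c p q r ->
    all (box_range p q r) (mkseq f n) && uniq (mkseq f n) ->
  {in gtn n &, injective (fun i => box_elt a b c (f i))}.
Proof.
move=> boxG /andP[/allP ranf uqf] i j; rewrite !unfold_in /= => li lj.
have ran k : k < n -> box_range p q r (f k).
  by move=> lk; apply/ranf/map_f; rewrite mem_iota.
move/(box_elt_inj boxG (ran i li) (ran j lj)) => eq_f.
apply/eqP; rewrite -(nth_uniq (f 0) _ _ uqf) ?size_mkseq //.
by rewrite !nth_mkseq // eq_f.
Qed.

Definition box_seq (gT : finGroupType) (a b c : gT) (s : seq (nat * nat * nat))
  (i : nat) := box_elt a b c (nth (0, 0, 0)%N s (i %% size s)).

Lemma box_cyclic_listing (gT : finGroupType) (G : {group gT}) (a b c : gT)
    (p q r : nat) (s : seq (nat * nat * nat)) :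
    box G a b c p q r ->
    [&& size s == (p * q * r)%N, all (box_range p q r) s & uniq s] ->
  cyclic_listing G (box_seq a b c s).
Proof.
move=> boxG /and3P[/eqP ss rs us]; rewrite /cyclic_listing (box_card boxG) -ss.
split=> [i | i | i j li lj]; first exact: box_elt_mem boxG.
  by rewrite /box_seq modnDr.
have := box_injective (n := size s) (f := nth (0, 0, 0)%N s) boxG.
rewrite mkseq_nth rs us => /(_ isT i j li lj).
by rewrite /box_seq !modn_small.
Qed.

(** [g] gives the index paired with [i]: the successor for harmonious listings, [id] or a parity
    shift for layers. *)
Definition box_sum (p q r : nat) (s t : seq (nat * nat * nat)) (g : nat -> nat)
    (i : nat) :=
  box_add p q r (nth (0, 0, 0)%N s (i %% size s)) (nth (0, 0, 0)%N t (g i %% size t)).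

Lemma box_seq_mul_inj (gT : finGroupType) (G : {group gT}) (a b c : gT)
    (p q r n : nat) (s t : seq (nat * nat * nat)) (g : nat -> nat)
    (f := mkseq (box_sum p q r s t g) n) :
    box G a b c p q r -> all (box_range p q r) f && uniq f ->
  {in gtn n &, injective (fun i => box_seq a b c s i * box_seq a b c t (g i))}.
Proof.
move=> boxG cf i j li lj; rewrite /box_seq !(box_eltM _ _ boxG).
exact: (box_injective boxG cf).
Qed.

Lemma box_harmonious (gT : finGroupType) (G : {group gT}) (a b c : gT)
    (p q r : nat) (s : seq (nat * nat * nat))
    (f := mkseq (box_sum p q r s s succn) (p * q * r)) :
    box G a b c p q r ->
    [&& size s == (p * q * r)%N, all (box_range p q r) s & uniq s] ->
    all (box_range p q r) f && uniq f ->
  harmonious_seq G (box_seq a b c s).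
Proof.
move=> boxG cs cf; have [sG sP sI] := box_cyclic_listing boxG cs.
by split=> //; rewrite (box_card boxG); apply: box_seq_mul_inj boxG cf.
Qed.

(** The test says that even-indexed products have an even exponent of [c], so they are products of
    powers of [a], [b] and [c ^+ 2]. *)
Lemma box_seq_even_sums (gT : finGroupType) (G L : {group gT}) (a b c : gT)
    (p q r : nat) (s : seq (nat * nat * nat)) :
    box G a b c p q r -> a \in L -> b \in L -> c ^+ 2 \in L ->
    ~~ odd (size s) -> 0 < size s ->
    all (fun k => odd k || ~~ odd (box_sum p q r s s succn k).2)
        (iota 0 (size s)) ->
  forall i, ~~ odd i -> box_seq a b c s i * box_seq a b c s i.+1 \in L.
Proof.
move=> boxG La Lb Lc evs s0 /allP ev i evi.
have := ev (i %% size s); rewrite mem_iota ltn_pmod // odd_mod ?(negbTE evs) //.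
rewrite (negbTE evi) orFb => /(_ isT) ev2.
rewrite /box_seq (box_eltM _ _ boxG).
have -> : i.+1 %% size s = (i %% size s).+1 %% size s.
  by rewrite -addn1 -modnDml addn1.
move: ev2; rewrite /box_sum modn_mod; move: (box_add _ _ _ _ _) => u ev2.
rewrite /box_elt -(even_halfK ev2) -mul2n expgM.
by apply: groupM; [apply: groupM|]; apply: groupX.
Qed.

(* The sequences below were found by computer search. *)
Lemma box_2_4_harmonious (gT : finGroupType) (G : {group gT}) (b c : gT) :
  box G 1 b c 1 2 4 -> harmonious G.
Proof.
pose s := [:: (0, 0, 0); (0, 0, 1); (0, 0, 2); (0, 1, 0);
              (0, 1, 2); (0, 0, 3); (0, 1, 1); (0, 1, 3)]%N.
by move=> boxG; exists (box_seq 1 b c s); apply: (box_harmonious boxG).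
Qed.

Lemma box_4_4_harmonious (gT : finGroupType) (G : {group gT}) (b c : gT) :
  box G 1 b c 1 4 4 -> harmonious G.
Proof.
pose s := [:: (0, 0, 0); (0, 1, 0); (0, 2, 0); (0, 0, 1);
              (0, 3, 0); (0, 1, 1); (0, 2, 1); (0, 0, 2);
              (0, 2, 2); (0, 3, 1); (0, 1, 2); (0, 3, 2);
              (0, 2, 3); (0, 0, 3); (0, 1, 3); (0, 3, 3)]%N.
by move=> boxG; exists (box_seq 1 b c s); apply: (box_harmonious boxG).
Qed.

(** The condition on even-indexed products starts the induction of [klein_cyclic_harmonious], where
    [L] is the join of a Klein four-group and [<[c ^+ 2]>]. *)
Lemma box_2_8_harmonious (gT : finGroupType) (G L : {group gT}) (b c : gT) :
    box G 1 b c 1 2 8 -> b \in L -> c ^+ 2 \in L ->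
  exists2 h, harmonious_seq G h & forall i, ~~ odd i -> h i * h i.+1 \in L.
Proof.
pose s := [:: (0, 0, 0); (0, 1, 0); (0, 0, 1); (0, 0, 3);
              (0, 0, 2); (0, 0, 4); (0, 1, 1); (0, 0, 5);
              (0, 1, 2); (0, 1, 6); (0, 1, 3); (0, 1, 7);
              (0, 1, 4); (0, 0, 6); (0, 1, 5); (0, 0, 7)]%N.
move=> boxG Lb Lc; exists (box_seq 1 b c s); first exact: (box_harmonious boxG).
exact: (box_seq_even_sums (s := s) boxG).
Qed.

Lemma box_2_2_4_harmonious (gT : finGroupType) (G L : {group gT}) (a b c : gT) :
    box G a b c 2 2 4 -> a \in L -> b \in L -> c ^+ 2 \in L ->
  exists2 h, harmonious_seq G h & forall i, ~~ odd i -> h i * h i.+1 \in L.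
Proof.
pose s := [:: (0, 0, 0); (0, 0, 2); (0, 0, 1); (0, 0, 3);
              (0, 1, 0); (1, 0, 0); (0, 1, 1); (1, 0, 1);
              (0, 1, 2); (1, 1, 0); (1, 1, 1); (0, 1, 3);
              (1, 1, 2); (1, 0, 2); (1, 1, 3); (1, 0, 3)]%N.
move=> boxG La Lb Lc; exists (box_seq a b c s); first exact: (box_harmonious boxG).
exact: (box_seq_even_sums (s := s) boxG).
Qed.

Lemma box_harmonious_quotient (gT : finGroupType) (G A : {group gT}) (a b c : gT)
    (p q r n : nat) (s1 sA sB sC : seq (nat * nat * nat))
    (listing := fun s => [&& size s == n, all (box_range p q r) s & uniq s])
    (transversal := fun s t g => let f := mkseq (box_sum p q r s t g) n in
       all (box_range p q r) f && uniq f) :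
    abelian G -> A \subset G -> box A a b c p q r -> n = (p * q * r)%N ->
    ~~ odd n -> 2 < #|G / A| -> harmonious (G / A) ->
    all listing [:: s1; sA; sB; sC] ->
    [&& transversal sA sB id, transversal sA sC id, transversal sB sC id,
        transversal sB s1 (fun i => odd i + i)%N
      & transversal sA s1 (fun i => ~~ odd i + i)%N] ->
  harmonious G.
Proof.
move=> abG sAG boxA en evn G3 hQ /and5P[l1 lA lB lC _].
move=> /and5P[tAB tAC tBC tB1 tA1].
have cA : #|A| = n by rewrite en; apply: box_card boxA.
have lst s : listing s -> cyclic_listing A (box_seq a b c s).
  by rewrite /listing en; apply: box_cyclic_listing.
apply: (harmonious_quotient (A := A) (P1 := box_seq a b c s1)
  (PA := box_seq a b c sA) (PB := box_seq a b c sB) (PC := box_seq a b c sC));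
  rewrite ?cA //; try exact: lst; exact: (box_seq_mul_inj boxA).
Qed.

Lemma harmonious_klein_quotient (gT : finGroupType) (G A : {group gT}) (a b : gT) :
    abelian G -> A \subset G -> box A a b 1 2 2 1 ->
    2 < #|G / A| -> harmonious (G / A) ->
  harmonious G.
Proof.
move=> abG sAG boxA G3 hQ.
(* Elements of the four-group are numbered from 0 to 3 by binary digits, so that listings are
   permutations of these numbers. *)
pose d (i : nat) := (i %% 2, i %/ 2, 0)%N : nat * nat * nat.
apply: (box_harmonious_quotient (n := 4) (s1 := map d [:: 0; 2; 3; 1]%N)
  (sA := map d [:: 2; 1; 0; 3]%N) (sB := map d [:: 1; 3; 0; 2]%N)
  (sC := map d [:: 3; 2; 0; 1]%N) abG sAG boxA) => //.
Qed.

(** Serves when the 2-part is elementary abelian of order 8: removing only a Klein four-group would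
    leave a Sylow 2-subgroup of order 2, which is cyclic. *)
Lemma harmonious_klein3_quotient (gT : finGroupType) (G A : {group gT}) (a b c : gT) :
    abelian G -> A \subset G -> box A a b c 2 2 2 ->
    2 < #|G / A| -> harmonious (G / A) ->
  harmonious G.
Proof.
move=> abG sAG boxA G3 hQ.
pose d (i : nat) := (i %% 2, i %/ 2 %% 2, i %/ 4)%N : nat * nat * nat.
apply: (box_harmonious_quotient (n := 8) (s1 := map d [:: 6; 0; 4; 1; 5; 3; 7; 2]%N)
  (sA := map d [:: 1; 4; 7; 3; 6; 0; 2; 5]%N)
  (sB := map d [:: 3; 7; 2; 5; 1; 0; 6; 4]%N)
  (sC := map d [:: 2; 3; 5; 6; 7; 0; 4; 1]%N) abG sAG boxA) => //.
Qed.

(** * Abelian groups *)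

Lemma order2P (gT : finGroupType) (x : gT) : x != 1 -> x ^+ 2 = 1 -> #[x] = 2.
Proof. by move=> nx1 x2; apply: nt_prime_order. Qed.

Lemma mem_klein (gT : finGroupType) (G : {group gT}) (a b w : gT) :
    abelian G -> a \in G -> b \in G -> #[a] = 2 -> #[b] = 2 ->
    w \in <[a]> <*> <[b]> ->
  [\/ w = 1, w = a, w = b | w = a * b].
Proof.
move=> abG Ga Gb oa ob; rewrite cent_joinEr; last first.
  by rewrite (sub_abelian_cent2 abG) // cycle_subG.
rewrite /= (cycle2g oa) (cycle2g ob); case/mulsgP=> x y.
rewrite !inE => /orP[]/eqP-> /orP[]/eqP-> ->.
- by rewrite mulg1; constructor 1.
- by rewrite mul1g; constructor 3.
- by rewrite mulg1; constructor 2.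
- by constructor 4.
Qed.

Lemma klein_square (gT : finGroupType) (G : {group gT}) (a b w : gT) :
    abelian G -> a \in G -> b \in G -> #[a] = 2 -> #[b] = 2 ->
    w \in <[a]> <*> <[b]> ->
  w ^+ 2 = 1.
Proof.
move=> abG Ga Gb oa ob; have a2 : a ^+ 2 = 1 by rewrite -oa expg_order.
have b2 : b ^+ 2 = 1 by rewrite -ob expg_order.
case/(mem_klein abG Ga Gb oa ob) => ->; rewrite ?expg1n //.
by rewrite expgMn ?a2 ?b2 ?mulg1 //; apply: (centsP abG).
Qed.

(** A nontrivial intersection would contain an involution, and [c ^+ (2 ^ k)] is the only one in
    [<[c]>]. *)
Lemma setI_cycle2_trivial (gT : finGroupType) (A : {group gT}) (c : gT) (k : nat) :
  #[c] = (2 ^ k.+1)%N -> c ^+ (2 ^ k) \notin A -> A :&: <[c]> = 1.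
Proof.
move=> oc; apply: contraNeq => ntI; pose I := (A :&: <[c]>)%G.
have pI : 2.-group I.
  by apply: pgroupS (subsetIr _ _) _; rewrite /pgroup -orderE oc pnatX.
have [_ dv2 _] := pgroup_pdiv pI ntI.
have [x] := Cauchy (isT : prime 2) dv2; rewrite inE => /andP[Ax cx] ox.
have oc2 : #[c ^+ (2 ^ k)] = 2 by rewrite (orderXexp _ oc) subSnn.
have : <[c ^+ (2 ^ k)]>%G == <[x]>%G :> {set gT}.
  rewrite (eq_subG_cyclic (cycle_cyclic c)) ?cycle_subG ?mem_cycle //.
  by rewrite -!orderE oc2 ox.
by rewrite -cycle_subG => /eqP->; rewrite cycle_subG.
Qed.

Lemma box_klein (gT : finGroupType) (G : {group gT}) (a b : gT) :
    abelian G -> a \in G -> b \in G -> #[a] = 2 -> #[b] = 2 -> a != b ->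
  box (<[a]> <*> <[b]>) a b 1 2 2 1.
Proof.
move=> abG Ga Gb oa ob nab.
have := box_intro abG Ga Gb (group1 G); rewrite oa ob order1 cycle1 joingG1.
apply; last by rewrite setIg1.
apply: (@setI_cycle2_trivial _ _ _ 0) => //; rewrite expg1 /= cycle2g // !inE negb_or.
by rewrite -order_gt1 ob eq_sym.
Qed.

Lemma box_klein3 (gT : finGroupType) (G : {group gT}) (a b c : gT) :
    abelian G -> a \in G -> b \in G -> c \in G ->
    #[a] = 2 -> #[b] = 2 -> #[c] = 2 -> a != b -> c \notin <[a]> <*> <[b]> ->
  box (<[a]> <*> <[b]> <*> <[c]>) a b c 2 2 2.
Proof.
move=> abG Ga Gb Gc oa ob oc nab nc.
have := box_intro abG Ga Gb Gc; rewrite oa ob oc.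
apply; last exact: (@setI_cycle2_trivial _ _ _ 0).
apply: (@setI_cycle2_trivial _ _ _ 0) => //; rewrite expg1 /= cycle2g // !inE negb_or.
by rewrite -order_gt1 ob eq_sym.
Qed.

Lemma noncyclic_two_involutions (gT : finGroupType) (G : {group gT}) :
    abelian G -> 2.-group G -> ~~ cyclic G ->
  exists a b, [/\ a \in G, b \in G, #[a] = 2, #[b] = 2 & a != b].
Proof.
move=> abG pG; rewrite abelian_rank1_cyclic // -ltnNge (rank_pgroup pG).
case/p_rank_geP=> E /pnElemP[sEG abE lE].
have cE : #|E| = 4.
  by rewrite -(part_pnat_id (abelem_pgroup abE)) p_part lE.
have [x Ex nx] : exists2 x, x \in E & x \notin [set 1].
  by apply/subsetPn/negP => /subset_leq_card; rewrite cE cards1.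
have [y Ey ny] : exists2 y, y \in E & y \notin [set 1; x].
  by apply/subsetPn/negP => /subset_leq_card; rewrite cE cards2; case: (_ != _).
move: nx ny; rewrite !inE negb_or => nx /andP[ny nyx].
exists x, y; rewrite !(subsetP sEG) // eq_sym; split=> //.
  exact: (abelem_order_p abE).
exact: (abelem_order_p abE).
Qed.

Lemma card_cycle_join (gT : finGroupType) (K : {group gT}) (c : gT) :
  c \in 'N(K) -> #|K <*> <[c]>| = (#|K| * #[coset K c])%N.
Proof.
move=> Nc; have sKG : K \subset K <*> <[c]> by apply: joing_subl.
rewrite -(Lagrange sKG) -card_quotient ?join_subG ?normG ?cycle_subG //.
by rewrite quotientYidl ?cycle_subG // quotient_cycle.
Qed.

(** [M] is a maximal proper subgroup above [S]; any [c] outside [M] generates [G] together with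
    [M]. *)
Lemma cyclic_quotient_supgroup (gT : finGroupType) (G S : {group gT}) :
    abelian G -> S \proper G ->
  exists (M : {group gT}) (c : gT),
    [/\ S \subset M, M \proper G, c \in G & G / M = <[coset M c]>].
Proof.
move=> abG pSG.
have [M /maxgroupP[pMG maxM] sSM] := @maxgroup_exists _ (fun M => M \proper G) _ pSG.
have [sMG [c Gc nMc]] := properP pMG.
exists M, c; split=> //.
have nMG : G \subset 'N(M) by rewrite (sub_abelian_norm abG).
have GE : M <*> <[c]> = G.
  have sMcG : M <*> <[c]> \subset G by rewrite join_subG sMG cycle_subG.
  move: sMcG; rewrite subEproper => /predU1P[// | pMc].
  have eM := maxM (M <*> <[c]>)%G pMc (joing_subl _ _).
  by case/negP: nMc; rewrite -eM (subsetP (joing_subr _ _)) ?cycle_id.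
by rewrite -[in LHS]GE quotientYidl ?quotient_cycle ?cycle_subG ?(subsetP nMG).
Qed.

Lemma harmonious_odd (gT : finGroupType) (G : {group gT}) :
  abelian G -> odd #|G| -> harmonious G.
Proof.
have [n] := ubnP #|G|; elim: n G => // n IHn G leG abG oG.
have [G1 | ntG] := eqVneq (G : {set gT}) 1.
  exists (fun=> 1); rewrite G1 /harmonious_seq cards1.
  by split=> [i | i | [|i] [|j] | [|i] [|j]] //; rewrite inE.
have [|M [c [_ pMG Gc defQ]]] := cyclic_quotient_supgroup (S := 1%G) abG.
  by rewrite properE sub1G subG1.
have sMG := proper_sub pMG.
apply: (harmonious_odd_ext abG sMG Gc defQ); first exact: quotient_odd.
apply: IHn; last exact: oddSg oG; last exact: abelianS abG.
exact: leq_trans (proper_card pMG) leG.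
Qed.

(** Induction on [k], passing from [c ^+ 2] to [c] by an index two extension. The second conclusion
    is the invariant: for [c ^+ 2] it puts the even-indexed products in [V <*> <[c ^+ 4]>], which
    does not contain [c ^+ 2]; multiplying by [c ^+ 2] moves them out, as [harmonious_double]
    requires. *)
Lemma klein_cyclic_harmonious (gT : finGroupType) (G : {group gT})
    (a b c : gT) (k : nat) (V := (<[a]> <*> <[b]>)%G) :
    abelian G -> a \in G -> b \in G -> c \in G -> #[a] = 2 -> #[b] = 2 ->
    a != b -> #[coset V c] = (2 ^ k.+2)%N ->
  exists2 h, harmonious_seq (V <*> <[c]>) h
    & forall i, ~~ odd i -> h i * h i.+1 \in V <*> <[c ^+ 2]>.
Proof.
move=> abG Ga Gb + oa ob nab; have boxV := box_klein abG Ga Gb oa ob nab.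
have cV : #|V| = 4 by rewrite (box_card boxV).
have sVG : V \subset G by rewrite join_subG !cycle_subG Ga.
have nVG : G \subset 'N(V) by rewrite (sub_abelian_norm abG).
have Va : a \in V by rewrite (subsetP (joing_subl _ _)) ?cycle_id.
have Vb : b \in V by rewrite (subsetP (joing_subr _ _)) ?cycle_id.
have sVxG x : x \in G -> V <*> <[x]> \subset G.
  by move=> Gx; rewrite join_subG sVG cycle_subG.
have Vsub x y : y \in V -> y \in V <*> <[x]>.
  exact: (subsetP (joing_subl _ _)).
have memr x : x \in V <*> <[x]>.
  by rewrite (subsetP (joing_subr _ _)) ?cycle_id.
have cosX x i : x \in G -> coset V x ^+ i = coset V (x ^+ i).
  by move=> Gx; rewrite morphX ?(subsetP nVG).
have memX x i : x \in G -> (x ^+ i \in V) = (#[coset V x] %| i).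
  move=> Gx; rewrite order_dvdn cosX //; apply/idP/eqP=> [/coset_id // |].
  by apply: coset_idr; rewrite (subsetP nVG) ?groupX.
have cVx x : x \in G -> #|V <*> <[x]>| = (4 * #[coset V x])%N.
  by move=> Gx; rewrite card_cycle_join ?cV ?(subsetP nVG).
elim: k c => [|k IHk] c Gc oc.
  have Vc4 : c ^+ 4 \in V by rewrite memX ?oc.
  have nVc2 : c ^+ 2 \notin V by rewrite memX ?oc.
  (* The group is [Z_2 ^ 2 * Z_4] when [c ^+ 4] is 1 and [Z_2 * Z_8] otherwise. *)
  have [c4 | nc4] := eqVneq (c ^+ 4) 1.
    have occ : #[c] = (2 ^ 2)%N.
      apply: orderXprime => //; apply: order2P; last by rewrite -expgM.
      by apply: contraNneq nVc2 => ->; rewrite group1.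
    have boxW : box (V <*> <[c]>) a b c 2 2 4.
      have := box_intro abG Ga Gb Gc; rewrite oa ob occ; apply.
        by have [_ /dprodP[[A B defA _] _ _ _] _ _ _] := boxV; have [] := dprodP defA.
      exact: (setI_cycle2_trivial occ).
    by apply: (box_2_2_4_harmonious (G := (V <*> <[c]>)%G)
      (L := (V <*> <[c ^+ 2]>)%G) boxW); rewrite /= ?memr ?Vsub.
  have oc4 : #[c ^+ 4] = 2.
    by apply: order2P => //; apply: (klein_square abG Ga Gb oa ob).
  have occ : #[c] = (2 ^ 3)%N by apply: (@orderXpfactor _ 2 2 2 c oc4).
  have [u [Vu ou nu]] : exists u, [/\ u \in V, #[u] = 2 & u != c ^+ 4].
    have [ec | nc] := eqVneq a (c ^+ 4); last by exists a.
    by exists b; rewrite -ec eq_sym.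
  have Gu : u \in G by apply: (subsetP sVG).
  have boxW : box (V <*> <[c]>) 1 u c 1 2 8.
    have bx : box (<[1]> <*> <[u]> <*> <[c]>) 1 u c 1 2 8.
      have := box_intro abG (group1 G) Gu Gc; rewrite ou occ order1; apply.
        by rewrite cycle1 setI1g.
      apply: (setI_cycle2_trivial occ).
      by rewrite /= cycle1 joing1G /= cycle2g // !inE negb_or nc4 eq_sym nu.
    suff -> : V <*> <[c]> = <[1]> <*> <[u]> <*> <[c]> by [].
    apply/esym/eqP; rewrite eqEcard (box_card (G := (<[1]> <*> <[u]> <*> <[c]>)%G) bx).
    rewrite cVx // oc andbT cycle1 joing1G join_subG !cycle_subG.
    by rewrite Vsub ?memr.
  by apply: (box_2_8_harmonious (G := (V <*> <[c]>)%G)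
    (L := (V <*> <[c ^+ 2]>)%G) boxW); rewrite /= ?memr ?Vsub.
have oc2 : #[coset V (c ^+ 2)] = (2 ^ k.+2)%N.
  by rewrite -cosX // (orderXexp 1 oc) subn1.
have oc4 : #[coset V ((c ^+ 2) ^+ 2)] = (2 ^ k.+1)%N.
  by rewrite -expgM -cosX // (orderXexp 2 oc) subn2.
have Gc2 : c ^+ 2 \in G by rewrite groupX.
have [h hs hev] := IHk _ Gc2 oc2.
have notin x : x \in G -> #[coset V x] = (#[coset V (x ^+ 2)] * 2)%N ->
  x \notin V <*> <[x ^+ 2]>.
  (* Otherwise joining [x] would not enlarge the group, whereas it doubles the order. *)
  move=> Gx ox; apply: contraL isT => Kx.
  have : V <*> <[x]> \subset V <*> <[x ^+ 2]>.
    by rewrite join_subG joing_subl cycle_subG.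
  move/subset_leq_card; rewrite !cVx ?groupX // leq_pmul2l // ox.
  by rewrite leqNgt ltn_Pmulr // order_gt0.
have nc := notin _ Gc; have nc2 := notin _ Gc2.
have abW : abelian (V <*> <[c]>) by apply: abelianS abG; apply: sVxG.
apply: (harmonious_double (G := (V <*> <[c]>)%G) (K := (V <*> <[c ^+ 2]>)%G) (c := c)
  abW _ _ _ _ _ _ hs) => //=.
- by rewrite join_subG joing_subl cycle_subG groupX.
- by rewrite !cVx // oc oc2 !expnSr !mulnA.
- by rewrite cVx // oddM.
- by apply: nc; rewrite oc oc2 expnSr.
- move=> i j evi evj; apply: contraL (hev i evi) => /eqP->.
  by rewrite groupMr ?hev // nc2 // oc2 oc4 expnSr.
Qed.

(* For abelian [G]: the Sylow 2-subgroup is noncyclic and [G] is not an elementary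
   abelian 2-group. *)
Definition good_group (gT : finGroupType) (G : {set gT}) :=
  (exists a b, [/\ a \in G, b \in G, #[a] = 2, #[b] = 2 & a != b]) /\
  exists2 x, x \in G & x ^+ 2 != 1.

(** Here every quotient by a Klein four-group has exponent at most 2. Squares are 1 or involutions,
    and [G] is [Z_2 * Z_4] or [Z_4 * Z_4], according to whether there is one nontrivial square or
    several. *)
Lemma harmonious_klein_squares (gT : finGroupType) (G : {group gT}) :
    abelian G -> good_group G ->
    (forall a b x, a \in G -> b \in G -> #[a] = 2 -> #[b] = 2 -> a != b ->
       x \in G -> x ^+ 2 \in <[a]> <*> <[b]>) ->
  harmonious G.
Proof.
move=> abG [[a [b [Ga Gb oa ob nab]]] [x Gx nx2]] sqV.
have com : {in G &, commutative mulg} by move=> y z /(centsP abG)Cy /Cy.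
have order_sq y : y \in G -> y ^+ 2 != 1 -> #[y ^+ 2] = 2.
  move=> Gy ny; apply: order2P => //.
  by apply: (klein_square abG Ga Gb oa ob); apply: sqV.
have order_4 y : y \in G -> y ^+ 2 != 1 -> #[y] = (2 ^ 2)%N.
  by move=> Gy ny; apply: (orderXprime (order_sq y Gy ny)).
have sqM y z : y \in G -> z \in G -> (y * z) ^+ 2 = y ^+ 2 * z ^+ 2.
  by move=> Gy Gz; apply: expgMn; apply: com.
have sqI y : y \in G -> y ^+ 2 * y ^+ 2 = 1.
  by move=> Gy; apply/(klein_square abG Ga Gb oa ob)/sqV.
have Ox := order_sq x Gx nx2; have Gv : x ^+ 2 \in G by rewrite groupX.
have invV u d : u \in G -> d \in G -> #[u] = 2 -> u != x ^+ 2 -> d ^+ 2 = 1 ->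
    d \in <[u]> <*> <[x]>.
  move=> Gu Gd ou nu d2.
  have Wu : u \in <[u]> <*> <[x]> by rewrite (subsetP (joing_subl _ _)) ?cycle_id.
  have Wx : x \in <[u]> <*> <[x]> by rewrite (subsetP (joing_subr _ _)) ?cycle_id.
  have [-> | nd1] := eqVneq d 1; first exact: group1.
  have od := order2P nd1 d2.
  have [-> // | ndu] := eqVneq d u.
  (* As a nontrivial square, [x ^+ 2] lies in the four-group of [d] and [u]; not being [u], it is
     [d] or [d * u]. *)
  have [e|e|e|e] := mem_klein abG Gd Gu od ou (sqV d u x Gd Gu od ou ndu Gx).
  - by rewrite e eqxx in nx2.
  - by rewrite -e groupX.
  - by rewrite e eqxx in nu.
  - by rewrite -(mulgK u d) -e groupM ?groupV ?groupX.
have [sqv | [y Gy [ny1 nyv]]] : (forall y, y \in G -> y ^+ 2 = 1 \/ y ^+ 2 = x ^+ 2) \/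
    exists2 y, y \in G & y ^+ 2 != 1 /\ y ^+ 2 != x ^+ 2.
- have [/forall_inP H | /forall_inPn[y Gy]] :=
    boolP [forall y in G, (y ^+ 2 == 1) || (y ^+ 2 == x ^+ 2)].
    by left=> y /H/orP[]/eqP; [left|right].
  by rewrite negb_or => /andP nn; right; exists y.
- have [u [Gu ou nu]] : exists u, [/\ u \in G, #[u] = 2 & u != x ^+ 2].
    have [ea | na] := eqVneq a (x ^+ 2); last by exists a.
    by exists b; rewrite -ea eq_sym.
  have bx : box (<[1]> <*> <[u]> <*> <[x]>) 1 u x 1 2 4.
    have := box_intro abG (group1 G) Gu Gx; rewrite ou (order_4 x) // order1; apply.
      by rewrite cycle1 setI1g.
    apply: (setI_cycle2_trivial (order_4 x Gx nx2)).
    by rewrite /= cycle1 joing1G /= cycle2g // !inE negb_or nx2 eq_sym.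
  rewrite cycle1 joing1G in bx.
  suff GE : <[u]> <*> <[x]> = G by rewrite GE in bx; apply: box_2_4_harmonious bx.
  apply/eqP; rewrite eqEsubset join_subG !cycle_subG Gu Gx /=.
  (* An element with the same square as [x] is [x] times an element of square 1. *)
  apply/subsetP=> y Gy; case: (sqv y Gy) => [|e]; first exact: invV.
  rewrite -(mulgKV x y) groupM ?(subsetP (joing_subr _ _) _ (cycle_id x)) //.
  by apply: invV; rewrite ?groupM ?groupV // sqM ?groupV // expgVn e mulgV.
- have Gu : y ^+ 2 \in G by rewrite groupX.
  have [Oy Oy4] := (order_sq y Gy ny1, order_4 y Gy ny1).
  have bx : box (<[1]> <*> <[y]> <*> <[x]>) 1 y x 1 4 4.
    have := box_intro abG (group1 G) Gy Gx.
    rewrite (order_4 x) // (order_4 y) // order1; apply.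
      by rewrite cycle1 setI1g.
    apply: (setI_cycle2_trivial (order_4 x Gx nx2)).
    (* If [x ^+ 2] is a power of [y], the exponent modulo 4 is 2: it is not 0 as [x ^+ 2] is
       nontrivial, and squaring excludes 1 and 3. *)
    rewrite /= cycle1 joing1G /=; apply: contra nyv => /cycleP[i].
    rewrite -(expg_mod_order y) (order_4 y) //.
    have := ltn_pmod i (isT : 0 < 4).
    case: (i %% _) => [|[|[|[|]]]] // _ e.
    - by rewrite e eqxx in nx2.
    - by move: ny1; rewrite -(expg1 y) -e expgS expg1 sqI ?eqxx.
    - by rewrite e.
    - by case/eqP: ny1; rewrite -(sqI x Gx) e -expgD -(expg_mod_order y (3 + 3)) Oy4.
  rewrite cycle1 joing1G in bx.
  suff GE : <[y]> <*> <[x]> = G by rewrite GE in bx; apply: box_4_4_harmonious bx.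
  apply/eqP; rewrite eqEsubset join_subG !cycle_subG Gy Gx /=.
  have Wx := subsetP (joing_subr <[y]> <[x]>) x (cycle_id x).
  have Wy := subsetP (joing_subl <[y]> <[x]>) y (cycle_id y).
  have invW d : d \in G -> d ^+ 2 = 1 -> d \in <[y]> <*> <[x]>.
    move=> Gd d2; have := invV _ d Gu Gd Oy nyv d2; apply: subsetP.
    by rewrite join_subG joing_subr cycle_subG groupX.
  have divW w s : w \in G -> s \in G -> s \in <[y]> <*> <[x]> -> w ^+ 2 = s ^+ 2 ->
      w \in <[y]> <*> <[x]>.
    move=> Gw Gs Ws e; rewrite -(mulgKV s w) groupM //.
    by apply: invW; rewrite ?groupM ?groupV // sqM ?groupV // expgVn e mulgV.
  have nxy : x ^+ 2 != y ^+ 2 by rewrite eq_sym.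
  apply/subsetP=> w Gw.
  have [e|e|e|e] := mem_klein abG Gv Gu Ox Oy (sqV _ _ w Gv Gu Ox Oy nxy Gw).
  - exact: invW.
  - exact: (divW w x).
  - exact: (divW w y).
  - by apply: (divW w (x * y)); rewrite ?groupM // sqM.
Qed.

Lemma harmonious_good (gT : finGroupType) (G : {group gT}) :
  abelian G -> good_group G -> harmonious G.
Proof.
have [n] := ubnP #|G|; elim: n gT G => // n IHn gT G leG abG goodG.
have [[a [b [Ga Gb oa ob nab]]] [x Gx nx2]] := goodG.
(* The quotient is handled by induction, or by [harmonious_odd] when the four-group is a whole Sylow
   2-subgroup. *)
have klein_quo u v : u \in G -> v \in G -> #[u] = 2 -> #[v] = 2 -> u != v ->
    2 < #|G / (<[u]> <*> <[v]>)| ->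
    good_group (G / (<[u]> <*> <[v]>)) \/ odd #|G / (<[u]> <*> <[v]>)| ->
    harmonious G.
  move=> Gu Gv ou ov nuv Q3 Qgood; have boxV := box_klein abG Gu Gv ou ov nuv.
  have sVG : <[u]> <*> <[v]> \subset G by rewrite join_subG !cycle_subG Gu.
  apply: (harmonious_klein_quotient (A := (<[u]> <*> <[v]>)%G) abG sVG boxV Q3).
  have abQ : abelian (G / (<[u]> <*> <[v]>)) by apply: quotient_abelian.
  case: Qgood => [Qg | Qodd]; last exact: harmonious_odd.
  apply: (IHn _ (G / (<[u]> <*> <[v]>))%G) => //.
  have ltQ : #|G / (<[u]> <*> <[v]>)| < #|G|.
    apply: (ltn_quotient (H := (<[u]> <*> <[v]>)%G)) => //; apply/trivgPn.
    by exists u; rewrite ?(subsetP (joing_subl _ _)) ?cycle_id // -order_gt1 ou.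
  exact: leq_trans ltQ leG.
have [S sylS] := Sylow_exists 2 G; have sSG := pHall_sub sylS.
have [GS | nGS] := eqVneq (S : {set gT}) G; last first.
  have pSG : S \proper G by rewrite properEneq nGS.
  have [M [c [sSM pMG Gc defQ]]] := cyclic_quotient_supgroup abG pSG.
  have sMG := proper_sub pMG.
  have nMG : G \subset 'N(M) by rewrite (sub_abelian_norm abG).
  have oddQ : odd #|G / M|.
    rewrite card_quotient // odd_2'nat; have [_ _] := and3P sylS.
    exact: pnat_dvd (indexgS G sSM).
  have S2 u : u \in G -> #[u] = 2 -> u \in M.
    move=> Gu ou; apply: (subsetP sSM).
    by rewrite (mem_normal_Hall sylS) -?sub_abelian_normal // /p_elt ou.
  (* The index of [M] is odd and exceeds 1, so it is at least 3. *)
  have Q3 (A : {group gT}) : A \subset M -> 2 < #|G / A|.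
    move=> sAM; apply: (@leq_trans #|G / M|).
      have: 1 < #|G / M| by rewrite card_quotient // indexg_gt1 proper_subn.
      by case: #|G / M| oddQ => [|[|[|]]].
    rewrite !card_quotient ?(sub_abelian_norm abG) ?(subset_trans sAM) //.
    by rewrite dvdn_leq ?indexg_gt0 ?indexgS.
  (* [M] contains all involutions of [G], so it is good unless it is an elementary abelian 2-group.
     In that case order 4, order 8 and larger orders are treated in turn. *)
  have [[y My ny2] | elM] : (exists2 y, y \in M & y ^+ 2 != 1) \/
      (forall y, y \in M -> y ^+ 2 = 1).
    have [/forall_inP H | /forall_inPn[y My ny]] :=
      boolP [forall y in M, y ^+ 2 == 1]; last by left; exists y.
    by right=> y /H/eqP.
    apply: (harmonious_odd_ext abG sMG Gc defQ oddQ).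
    apply: IHn; [exact: leq_trans (proper_card pMG) leG | exact: abelianS abG |].
    by split; [exists a, b; rewrite !S2 | exists y].
  have sVM : <[a]> <*> <[b]> \subset M by rewrite join_subG !cycle_subG !S2.
  have [V_M | nVM] := eqVneq (<[a]> <*> <[b]>) M.
    apply: (klein_quo a b) => //; first exact: (Q3 (<[a]> <*> <[b]>)%G).
    by right; rewrite V_M.
  have [d Md nVd] : exists2 d, d \in M & d \notin <[a]> <*> <[b]>.
    by apply/subsetPn/proper_subn; rewrite properEneq nVM.
  have Gd := subsetP sMG d Md.
  have od : #[d] = 2.
    by apply: order2P; rewrite ?elM //; apply: contraNneq nVd => ->; rewrite group1.
  have boxW := box_klein3 abG Ga Gb Gd oa ob od nab nVd.
  have sWM : <[a]> <*> <[b]> <*> <[d]> \subset M by rewrite join_subG sVM cycle_subG.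
  have sWG := subset_trans sWM sMG.
  have [W_M | nWM] := eqVneq (<[a]> <*> <[b]> <*> <[d]>) M.
    apply: (harmonious_klein3_quotient
      (A := (<[a]> <*> <[b]> <*> <[d]>)%G) abG sWG boxW).
      exact: Q3.
    by apply: harmonious_odd; [exact: quotient_abelian | rewrite /= W_M].
  have [f Mf nWf] : exists2 f, f \in M & f \notin <[a]> <*> <[b]> <*> <[d]>.
    by apply/subsetPn/proper_subn; rewrite properEneq nWM.
  have Gf := subsetP sMG f Mf.
  apply: (klein_quo a b) => //; first exact: (Q3 (<[a]> <*> <[b]>)%G).
  left; pose V := (<[a]> <*> <[b]>)%G.
  have nVG : G \subset 'N(V) by rewrite (sub_abelian_norm abG) // (subset_trans sVM).
  have sVW : V \subset <[a]> <*> <[b]> <*> <[d]> by apply: joing_subl.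
  have oV u : u \in M -> u \notin V -> #[coset V u] = 2.
    move=> Mu nVu; have Nu := subsetP nVG u (subsetP sMG u Mu).
    apply: order2P; last by rewrite -morphX // elM // morph1.
    by apply: contra nVu => /eqP; apply: coset_idr.
  (* The quotient by [V] is good: [d] and [f] give two involutions, and an element outside [M] gives
     a nontrivial square because [G / M] has odd order. *)
  split.
    exists (coset V d), (coset V f); rewrite !mem_quotient // !oV //; last first.
      by apply: contra nWf; apply: subsetP.
    split=> //; apply: contraNneq nWf => edf.
    have Vdf : f * d^-1 \in V.
      apply: coset_idr; first by rewrite (subsetP nVG) ?groupM ?groupV.
      by rewrite morphM ?morphV ?groupV ?(subsetP nVG) //= edf mulgV.
    rewrite -(mulgKV d f); apply: groupM; first exact: (subsetP sVW).
    by rewrite (subsetP (joing_subr _ _)) ?cycle_id.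
  have [_ [g Gg nMg]] := properP pMG.
  exists (coset V g); rewrite ?mem_quotient //.
  apply: contra nMg => /eqP; rewrite -morphX ?(subsetP nVG) //= => cg2.
  have Ng := subsetP nMG g Gg; apply: coset_idr => //.
  have g2M : g ^+ 2 \in M.
    by apply: (subsetP sVM); apply: coset_idr; rewrite ?(subsetP nVG) ?groupX.
  apply/eqP; rewrite -order_eq1 -dvdn1 -(eqP (_ : coprime 2 #|G / M|)) ?coprime2n //.
  rewrite dvdn_gcd order_dvdG ?mem_quotient // andbT order_dvdn.
  by rewrite -morphX //= coset_id.
have pG : 2.-group G by rewrite -GS (pHall_pgroup sylS).
have [/forall_inP sqV | ] := boolP [forall a in G, forall b in G, forall x in G,
    [&& #[a] == 2, #[b] == 2 & a != b] ==> (x ^+ 2 \in <[a]> <*> <[b]>)].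
  apply: harmonious_klein_squares => // u v w Gu Gv ou ov nuv Gw.
  have /forall_inP/(_ v Gv)/forall_inP/(_ w Gw) := sqV u Gu.
  by rewrite ou ov nuv.
(* Some four-group [V] misses the square of some [w]. Then [G / V] has a nontrivial square, and it
   is good unless it is cyclic. *)
case/forall_inPn=> u Gu /forall_inPn[v Gv] /forall_inPn[w Gw].
rewrite negb_imply => /andP[/and3P[/eqP ou /eqP ov nuv] nVw].
pose V := (<[u]> <*> <[v]>)%G.
have sVG : V \subset G by rewrite join_subG !cycle_subG Gu.
have nVG : G \subset 'N(V) by rewrite (sub_abelian_norm abG).
have Qw : coset V w \in G / V by rewrite mem_quotient.
have nw2 : coset V w ^+ 2 != 1.
  apply: contra nVw => /eqP; rewrite -morphX ?(subsetP nVG) //=.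
  by apply: coset_idr; rewrite (subsetP nVG) ?groupX.
have Q3 : 2 < #|G / V|.
  rewrite ltnNge; apply: contra nw2 => Q2; rewrite -order_dvdn.
  apply: dvdn_trans (order_dvdG Qw) _.
  by case: #|G / V| (cardG_gt0 (G / V)) Q2 => [|[|[|]]].
have [/cyclicP[z defQ] | ncQ] := boolP (cyclic (G / V)); last first.
  apply: (klein_quo u v) => //; left; split; last by exists (coset V w).
  apply: noncyclic_two_involutions ncQ; first exact: quotient_abelian.
  exact: quotient_pgroup.
have /morphimP[c Nc Gc ec] : z \in G / V by rewrite defQ cycle_id.
have [k oc] : exists k, #[coset V c] = (2 ^ k.+2)%N.
  have oc : #[coset V c] = #|G / V| by rewrite defQ ec.
  have := card_pgroup (quotient_pgroup V pG); rewrite -oc => e.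
  move: e Q3; rewrite -oc; case: (logn _ _) => [|[|k]] ->; rewrite ?expn0 ?expn1 //.
  by exists k.
have [h hs _] := klein_cyclic_harmonious abG Gu Gv Gc ou ov nuv oc.
suff GE : V <*> <[c]> = G by exists h; rewrite -GE.
apply/eqP; rewrite eqEcard join_subG sVG cycle_subG Gc /=.
rewrite card_cycle_join ?(subsetP nVG) // -(Lagrange sVG) leq_pmul2l //.
by rewrite -card_quotient // defQ ec.
Qed.

(** * The closed web *)

(** The pairs (1, 0) and (0, s) are distinct involutions, and the double of (0, 1) is nonzero since
    [2 * s] exceeds 2. *)
Lemma good_group_isog (gT : finGroupType) (H K : {group gT}) (s : nat) :
    2 <= s -> K \subset H -> K \isog setX [set: 'Z_2] [set: 'Z_(2 * s)] ->
  good_group H.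
Proof.
move=> s2 sKH; rewrite isog_sym => /isogP[f injf imf].
have fH u : f u \in H by apply: (subsetP sKH); rewrite -imf mem_morphim // !inE.
have inX (u : 'Z_2 * 'Z_(2 * s)) : u \in setX [set: 'Z_2] [set: 'Z_(2 * s)].
  by rewrite !inE.
have of_ u : #[f u] = #[u] by apply: order_injm.
have s2gt1 : 1 < 2 * s by lia.
have val_s k : ((k%:R)%R : 'Z_(2 * s)) = k %% (2 * s) :> nat by apply: val_Zp_nat.
have oa : #[(1%R, 0%R) : 'Z_2 * 'Z_(2 * s)] = 2.
  by apply: order2P => //; apply/eqP; rewrite -pair_eqE.
have ob : #[(0%R, s%:R%R) : 'Z_2 * 'Z_(2 * s)] = 2.
  apply: order2P.
    rewrite -pair_eqE /= -val_eqE /= (val_s s); rewrite modn_small //; lia.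
  suff e0 : (s%:R + s%:R)%R = 0%R :> 'Z_(2 * s).
    exact: (congr2 pair (GRing.addr0 (0%R : 'Z_2)) e0).
  by rewrite -GRing.natrD addnn -mul2n; apply: ord_inj; rewrite val_s modnn.
have n2 : (1 + 1)%R != 0%R :> 'Z_(2 * s).
  rewrite -(GRing.natrD _ 1 1); apply/eqP => /(congr1 (@nat_of_ord _)).
  by rewrite val_s modn_small //; lia.
split.
  exists (f (1%R, 0%R)), (f (0%R, s%:R%R)); rewrite !fH !of_ oa ob; split=> //.
  by apply/eqP=> /(injmP injf)-/(_ (inX _) (inX _)).
exists (f (0%R, 1%R)) => //.
by rewrite -morphX ?inX // -(morph1 f) (inj_in_eq (injmP injf)) ?inX.
Qed.

(* [(i, j, false)] indexes the cycle edge from [(i, j)] to [(i, j + 1)], and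
   [(i, j, true)] the edge going up from [(i, j)]. *)
Definition web_edge_ends (m n : nat) (t : 'I_m * 'I_n * bool) :
    option ('I_m * 'I_n) * option ('I_m * 'I_n) :=
  let: (i, j, b) := t in
  if b then ((if i == 0 :> nat then None else Some (ord_pred i, j)), Some (i, j))
  else (Some (i, j), Some (i, ordS j)).

Definition web_edge (m n : nat) (t : 'I_m * 'I_n * bool) :=
  [set (web_edge_ends t).1; (web_edge_ends t).2].

Lemma val_ord_pred (m : nat) (i : 'I_m) : 0 < i -> ord_pred i = i.-1 :> nat.
Proof.
move=> i0; rewrite /= -(prednK i0) addSn /= modnDr modn_small //.
by rewrite prednK // ltnW.
Qed.

Lemma web_edge_adj (m n : nat) (t : 'I_m * 'I_n * bool) :
  closed_web (web_edge_ends t).1 (web_edge_ends t).2.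
Proof.
case: t => [[i j] []] /=; last first.
  by rewrite /prism /cartesian_product /cycle_graph /= !eqxx.
case: ifP => [// | /negbT]; rewrite -lt0n => i0.
have: (ord_pred i).+1 = i by rewrite val_ord_pred // prednK.
move: (ord_pred i) => p pi; rewrite /= /prism /cartesian_product /path_graph /=.
by rewrite pi !eqxx orbT.
Qed.

Lemma closed_web_edge (m n : nat) (x y : option ('I_m * 'I_n)) :
  closed_web x y -> exists t, [set x; y] = web_edge t.
Proof.
have pred_eq (i k : 'I_m) : (i.+1 == k)%N -> (k != 0 :> nat) /\ ord_pred k = i.
  move=> /eqP ik; have k0 : 0 < k by rewrite -ik.
  by split; [rewrite -lt0n | apply: ord_inj; rewrite val_ord_pred // -ik].
case: x y => [[i j]|] [[k l]|] //=.
- rewrite /prism /cartesian_product /cycle_graph /path_graph /=.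
  case/orP=> /andP[].
    move=> /eqP<- /orP[]/eqP<-; first by exists (i, j, false).
    by exists (i, l, false); rewrite setUC.
  case/orP=> /pred_eq[k0 ei] /eqP<-.
    by exists (k, j, true); rewrite /web_edge /= (negbTE k0) ei.
  by exists (i, j, true); rewrite /web_edge /= (negbTE k0) ei setUC.
- by move=> i0; exists (i, j, true); rewrite /web_edge /= i0 setUC.
- by move=> k0; exists (k, l, true); rewrite /web_edge /= k0.
Qed.

(** Distinct labels force distinct edges, so the triples index at least [#|Gamma|] edges, and an
    injective labeling of these is bijective. *)
Lemma harmonious_labelingP (m n : nat) (Gamma : finZmodType)
    (f : option ('I_m * 'I_n) -> Gamma) :
    1 < n -> #|Gamma| = (2 * m * n)%N -> injective f ->
    injective (fun t => (f (web_edge_ends t).1 + f (web_edge_ends t).2)%R) ->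
  harmonious_labeling (@closed_web m n) f.
Proof.
move=> n1 cG fI labI; split=> //.
have labE t : edge_label f (web_edge t) =
    (f (web_edge_ends t).1 + f (web_edge_ends t).2)%R.
  apply: edge_labelE; apply/eqP => e; have := web_edge_adj t.
  by rewrite e closed_web_irr.
have webP e : e \in edges (@closed_web m n) -> exists t, e = web_edge t.
  by case/imsetP=> -[x y]; rewrite inE => /closed_web_edge[t xy] ->; exists t.
have webI : injective (@web_edge m n).
  by move=> t u /(congr1 (edge_label f)); rewrite !labE => /labI.
apply: inj_card_bij => [e e' | ].
  have [[t et] [u eu]] := (webP _ (valP e), webP _ (valP e')).
  by rewrite et eu !labE => /labI tu; apply: val_inj; rewrite et eu tu.
rewrite cG card_sig -mulnA mulnC -[m in leqLHS]card_ord -[n in leqLHS]card_ord.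
rewrite -card_bool -!card_prod -(card_imset _ webI); apply: subset_leq_card.
apply/subsetP=> _ /imsetP[t _ ->]; apply/imsetP.
by exists (web_edge_ends t); rewrite // inE web_edge_adj.
Qed.

Local Close Scope group_scope.

Theorem theorem8p1 (m n : nat) (Gamma : finZmodType) (H : {group Gamma})
  (hn : 3 <= n) (hm : 2 <= m)
  (hGamma : #|Gamma| = 2 * m * n)
  (hH : #|H| = n)
  (hcase : odd n \/
    (~~ odd n /\
     exists (s : nat) (K : {group Gamma}),
       [/\ 2 <= s, K \subset H & K \isog setX [set: 'Z_2] [set: 'Z_(2 * s)]]))
  (hquot : cyclic ([set: Gamma] / H)%g) :
  exists f : option ('I_m * 'I_n) -> Gamma,
    harmonious_labeling (@closed_web m n) f.
Proof.
have abT : abelian [set: Gamma] by apply: FinRing.zmod_abelian.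
have abH : abelian H := abelianS (subsetT H) abT.
have [h hh] : harmonious H.
  case: hcase => [odd_n | [_ [s [K [s2 sKH isoK]]]]].
    by apply: harmonious_odd; rewrite ?hH.
  by apply: harmonious_good => //; apply: good_group_isog isoK.
have [hHm hP _ _] := hh; rewrite hH in hP.
have nH x : (x \in 'N(H))%g.
  by rewrite (subsetP (sub_abelian_norm abT (subsetT H))) ?inE.
have cQ : #|[set: Gamma] / H|%g = 2 * m.
  have n0 : 0 < n by apply: leq_trans hn.
  apply/eqP; rewrite -(eqn_pmul2r n0) -hGamma -(cardsT Gamma).
  rewrite card_quotient ?(sub_abelian_norm abT) // -[X in _ * X]hH mulnC.
  by rewrite Lagrange ?subsetT.
have /cyclicP[z defQ] := hquot.
have /morphimP[g _ _ eg] : z \in ([set: Gamma] / H)%g by rewrite defQ cycle_id.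
have og : #[coset H g]%g = 2 * m by rewrite -cQ defQ eg.
have com (x y : Gamma) : (x * y = y * x)%g by apply: (centsP abT); rewrite inE.
have eq_mod i j x y : x \in H -> y \in H -> (g ^+ i * x = g ^+ j * y)%g ->
    i = j %[mod 2 * m].
  move=> Hx Hy /(congr1 (coset H)).
  rewrite !morphM ?nH //= (coset_id Hx) (coset_id Hy) !mulg1.
  by rewrite !morphX ?nH // => /eqP; rewrite eq_expg_mod_order og => /eqP.
have eq_lt i j x y : x \in H -> y \in H -> i < 2 * m -> j < 2 * m ->
    (g ^+ i * x = g ^+ j * y)%g -> i = j /\ x = y.
  move=> Hx Hy li lj e; have := eq_mod _ _ _ _ Hx Hy e; rewrite !modn_small //.
  by move=> eij; split=> //; move: e; rewrite eij => /mulgI.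
have gH : (g ^+ (2 * m) \in H)%g.
  by apply: coset_idr; rewrite ?nH // morphX ?nH // -og expg_order.
(* This gives the additional vertex the exponent [2 m - 1], out of reach of the layers, whose
   exponents are below [m]. *)
have gVE : (g^-1 = g ^+ (2 * m).-1 * (g ^+ (2 * m))^-1)%g.
  have m0 : 0 < 2 * m by lia.
  rewrite -[in X in (_ * X^-1)%g](prednK m0) expgSr invMg mulgA.
  by rewrite com mulgA mulVg mul1g.
pose f (v : option ('I_m * 'I_n)) : Gamma :=
  if v is Some (i, j) then (g ^+ i * h (i + j))%g else g^-1%g.
have hmodI i (j j' : 'I_n) : i + j = i + j' %[mod n] -> j = j'.
  by move=> /eqP; rewrite eqn_modDl !modn_small // => /eqP/ord_inj.
exists f; apply: harmonious_labelingP => //; first exact: ltnW.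
  have ltm (i : 'I_m) : i < 2 * m by have := ltn_ord i; lia.
  have ltp : (2 * m).-1 < 2 * m by lia.
  have gH' : ((g ^+ (2 * m))^-1 \in H)%g by rewrite groupV.
  case=> [[i j]|] [[k l]|] //=; rewrite ?gVE => /eq_lt[] //.
  - by move/ord_inj->; move/(harmonious_seq_eq hh); rewrite hH => /hmodI->.
  - by move=> ei; have := ltn_ord i; lia.
  - by move=> ei; have := ltn_ord k; lia.
(* Edge labels take the form [g ^+ e t * k t] with [k t] in [H]. The exponent is [2 i] on the cycle
   of layer [i], [2 i - 1] between layers [i - 1] and [i], and [2 m - 1] on spokes. *)
pose e (t : 'I_m * 'I_n * bool) :=
  let: (i, _, b) := t in
  if b then (if i == 0 :> nat then (2 * m).-1 else i.*2.-1) else i.*2.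
pose k (t : 'I_m * 'I_n * bool) : Gamma :=
  let: (i, j, b) := t in
  (if b then (if i == 0 :> nat then (g ^+ (2 * m))^-1 * h (i + j)
      else h (i.-1 + j) * h (i.-1 + j).+1) else h (i + j) * h (i + j).+1)%g.
have kH t : k t \in H.
  by case: t => [[i j] []] /=; [case: ifP => _|]; rewrite groupM ?groupV.
have labE t : (f (web_edge_ends t).1 * f (web_edge_ends t).2 = g ^+ e t * k t)%g.
  have swap (x y u w : Gamma) : (x * y * (u * w) = x * u * (y * w))%g.
    by rewrite !mulgA -(mulgA x y) (com y u) !mulgA.
  case: t => [[i j] b]; case: b; last first.
    rewrite /f /= swap -expgD addnn; congr (_ * (_ * _))%g.
    (* The wrap of [ordS] at [n] is absorbed by the period of [h]. *)
    rewrite -addnS -(periodic_modn (i + j.+1) hP) -(periodic_modn (i + _) hP).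
    by rewrite modnDmr.
  rewrite /web_edge_ends /e /k; case: ifP => [/eqP i0 | /negbT].
    by rewrite /f /= i0 expg0 mul1g gVE -mulgA.
  rewrite -lt0n => i0; have := val_ord_pred i0.
  move: (ord_pred i) => p ep; rewrite /f /= ep swap -expgD.
  congr (g ^+ _ * (_ * h _))%g; lia.
have e_lt t : e t < 2 * m.
  by case: t => [[i j] []] /=; have := ltn_ord i; [case: ifP => _|]; lia.
have hsumI i (j j' : 'I_n) :
    (h (i + j) * h (i + j).+1 = h (i + j') * h (i + j').+1)%g -> j = j'.
  by move/(harmonious_seq_sum_eq hh); rewrite hH => /hmodI.
move=> t u; rewrite -!FinRing.zmodMgE !labE => /eq_lt[] //.
case: t u => [[i j] b] [[i' j'] b'] et.
(* Parity separates cycle edges from the others, and exponents between layers stop at [2 m - 3],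
   below that of the spokes. *)
have [ei eb] : i = i' :> nat /\ b = b'.
  have [li li'] := (ltn_ord i, ltn_ord i').
  move: et; rewrite /e; case: (b) (b') => [] [];
  by do ?[case: ifP => [/eqP|/eqP] ?]; lia.
move: et => _; move/ord_inj: ei => ei; subst i' b'; rewrite /k.
case: b; last by move/hsumI->.
case: ifP => [_ /mulgI/(harmonious_seq_eq hh) | _ /hsumI-> //].
by rewrite hH => /hmodI->.
Qed.
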